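(* Let $\|a\|_1=\sum_{i=1}^k |a_i|$. If $k\geq 3$ and $a_i\neq 0$ for $1\leq i\leq k$, then \begin{equation*} R(N)=O\bigl(N^{\frac{1}{2}-\frac{1}{c(k)\|a\|_1}}\bigr). \end{equation*}
   Context: Fix integer coefficients $a_1,\dotsc,a_k$ and consider the symmetric linear equation $a_1x_1+\dotsb+a_kx_k=a_1x_{k+1}+\dotsb+a_kx_{2k}$. $R(N)$ denotes the size of a largest set of integers in $[1,N]$ containing no solution to this equation in distinct integers (i.e. with all $2k$ variables assigned pairwise different values). $c(k)$ is a constant depending only on $k$. *)

(* Defs.v *)
From mathcomp Require Import all_boot all_order all_algebra.
From mathcomp Require Import all_classical all_reals all_analysis.

Set Implicit Arguments.
Unset Strict Implicit.
Unset Printing Implicit Defensive.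

Import Order.TTheory GRing.Theory Num.Theory.
Import numFieldNormedType.Exports.
Local Open Scope ring_scope.

(* x (lshift k i) and x (rshift k i) are the variables x_i and x_(k+i). *)
Definition symmetric_solution (k : nat) (a : 'I_k -> int)
    (x : 'I_(k + k) -> int) : bool :=
  \sum_(i < k) a i * x (lshift k i) == \sum_(i < k) a i * x (rshift k i).

(* A subset of [1, N] is encoded as a set of elements of 'I_N.+1 = {0, ..., N}
   that does not contain 0. *)
Definition in_1N (N : nat) (A : {set 'I_N.+1}) : bool := ord0 \notin A.

Definition has_distinct_solution (k : nat) (a : 'I_k -> int) (N : nat)
    (A : {set 'I_N.+1}) : bool :=
  [exists x : {ffun 'I_(k + k) -> 'I_N.+1},
    [&& injectiveb x, [forall i, x i \in A]
      & symmetric_solution a (fun i => (x i : nat)%:Z)]].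

(* R(N), for the equation with coefficients a. *)
Definition max_free (k : nat) (a : 'I_k -> int) (N : nat) : nat :=
  (\max_(A : {set 'I_N.+1} | in_1N A && ~~ has_distinct_solution a A) #|A|)%N.

Definition l1norm (k : nat) (a : 'I_k -> int) : nat :=
  (\sum_(i < k) `|a i|)%N.

(* Main.v *)
Require Import Defs.
From mathcomp Require Import all_boot all_order all_algebra.
From mathcomp Require Import all_classical all_reals all_analysis.
From mathcomp Require Import fintype finfun finset.
From mathcomp Require Import zify ring lra.

(** Let [A] be solution-free with [n] elements, [h] the l1-norm of [a], and
    embed [[0, N]] in a cyclic group of order about [2 h N], so that nothing
    wraps around.  Cauchy-Schwarz yields at least [n^(2k) / |G|] solutions, all
    of which have two equal variables.  Merging these two leaves at least four
    variables with nonzero coefficients, so by Cauchy-Schwarz again there are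
    at most [(2k)^2 n^(2k-5) E(A)] solutions, [E] being the additive energy.
    Hence [E(A) >= n^3 / K] with [K] of order [N / n^2].  By the
    Balog-Szemeredi-Gowers theorem a subset [A'] with [n <= O(K) |A'|]
    satisfies [|A' - A'| <= M |A'|], [M] polynomial in [K], whence
    [|h A'| <= M^h |A'|] by Plunnecke's inequality.  Cauchy-Schwarz on [A'] now
    gives at least [|A'|^(2k-1) M^(-h)] solutions, against at most
    [(2k)^2 |A'|^(2k-2)] degenerate ones, so [n] is bounded by a constant times
    [K^(10 h + 1)].  If [n > N^(1/2 - d)] then [K <= O(N^(2 d))], and
    [d = 1 / (100 h)] is small enough to conclude. *)

Set Implicit Arguments.
Unset Strict Implicit.
Unset Printing Implicit Defensive.
Import Order.TTheory GRing.Theory Num.Theory.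
Import numFieldNormedType.Exports.

(** * Cauchy-Schwarz and additive energy *)

(** Expand both sides over pairs of indices, symmetrize, and use [2uv <= u^2 + v^2] with
    [u = f i * g j] and [v = f j * g i]. *)
Lemma sum_nat_CS (I : finType) (P : pred I) (f g : I -> nat) :
  (\sum_(i | P i) f i * g i) ^ 2 <=
  (\sum_(i | P i) f i ^ 2) * (\sum_(i | P i) g i ^ 2).
Proof.
rewrite -(@leq_pmul2l 2) // -mulnn !big_distrlr /=.
have -> : 2 * (\sum_(i | P i) \sum_(j | P j) f i ^ 2 * g j ^ 2) =
  \sum_(i | P i) \sum_(j | P j) ((f i * g j) ^ 2 + (f j * g i) ^ 2).
  rewrite mul2n -addnn {2}exchange_big /= -big_split; apply: eq_bigr => i _ /=.
  by rewrite -big_split; apply: eq_bigr => j _ /=; rewrite !expnMn.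
rewrite big_distrr; apply: leq_sum => i _; rewrite big_distrr.
apply: leq_sum => j _ /=.
have := (nat_Cauchy (f i * g j) (f j * g i)).1; lia.
Qed.

Section Collisions.
Variables (W : finType).

Definition coll (U V : finType) (P : {set U}) (f : U -> W)
    (Q : {set V}) (g : V -> W) : nat :=
  \sum_(u in P) \sum_(v in Q) (f u == g v).

Definition fiber (U : finType) (P : {set U}) (f : U -> W) (w : W) : nat :=
  \sum_(u in P) (f u == w).

Lemma fiberE (U : finType) (P : {set U}) (f : U -> W) w :
  fiber P f w = #|[set u in P | f u == w]|.
Proof.
rewrite /fiber -sum1dep_card big_mkcondr /=.
by apply: eq_bigr => u _; case: eqP.
Qed.

Lemma sum_fiber (U : finType) (P : {set U}) (f : U -> W) :
  \sum_w fiber P f w = #|P|.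
Proof.
rewrite exchange_big /= -sum1_card; apply: eq_bigr => u _.
rewrite (bigD1 (f u)) //= eqxx big1 ?addn0 // => w /negPf.
by rewrite eq_sym => ->.
Qed.

Lemma coll_fiber (U V : finType) (P : {set U}) (f : U -> W)
    (Q : {set V}) (g : V -> W) :
  coll P f Q g = \sum_w fiber P f w * fiber Q g w.
Proof.
under [RHS]eq_bigr do rewrite /fiber big_distrlr /=.
rewrite exchange_big /=; apply: eq_bigr => u _.
rewrite exchange_big /=; apply: eq_bigr => v _.
rewrite (bigD1 (f u)) //= eqxx mul1n eq_sym big1 ?addn0 // => w /negPf.
by rewrite eq_sym => ->.
Qed.

(** By [coll_fiber] a collision count is the inner product of two fiber-size vectors, so
    Cauchy-Schwarz separates the two maps. *)
Lemma coll_CS (U V : finType) (P : {set U}) (f : U -> W)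
    (Q : {set V}) (g : V -> W) :
  coll P f Q g ^ 2 <= coll P f P f * coll Q g Q g.
Proof.
by rewrite !coll_fiber (leq_trans (sum_nat_CS _ _ _)).
Qed.

(** This is [coll_CS] with the identity of [H] as second map: each [u] in [P] meets exactly one
    point of [H], and [H] meets itself [#|H|] times. *)
Lemma card_CS (U : finType) (P : {set U}) (f : U -> W) (H : {set W}) :
  {in P, forall u, f u \in H} -> #|P| ^ 2 <= #|H| * coll P f P f.
Proof.
move=> fH; rewrite mulnC.
have E1 : coll P f H id = #|P|.
  rewrite -sum1_card; apply: eq_bigr => u /fH fu.
  rewrite (bigD1 (f u)) //= eqxx big1 ?addn0 // => w /andP[_ /negPf].
  by rewrite eq_sym => ->.
have E2 : coll H id H id = #|H|.
  rewrite -sum1_card; apply: eq_bigr => u uH.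
  rewrite (bigD1 u) //= eqxx big1 ?addn0 // => w /andP[_ /negPf].
  by rewrite eq_sym => ->.
by rewrite -E1 -E2 coll_CS.
Qed.

End Collisions.

Local Open Scope ring_scope.

Section Energy.
Variable G : finZmodType.
Implicit Types A X Y C : {set G}.

Definition energy A : nat :=
  coll (setX A A) (fun p => p.1 - p.2) (setX A A) (fun p => p.1 - p.2).

(** One half of a Freiman isomorphism. Dilation by a nonzero coefficient satisfies it on a set where
    nothing wraps around. *)
Definition freiman A (g : G -> G) :=
  forall x y z t, x \in A -> y \in A -> z \in A -> t \in A ->
    g x - g y = g z - g t -> x - y = z - t.

Lemma big_setX A X (F : G -> G -> nat) :
  (\sum_(p in setX A X) F p.1 p.2 = \sum_(x in A) \sum_(y in X) F x y)%N.
Proof.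
rewrite pair_big /=; apply: eq_bigl => p; by rewrite inE.
Qed.

Lemma leq_sqr_anti m n : (m ^ 2 <= n ^ 2 -> m <= n)%N.
Proof. by rewrite leq_exp2r. Qed.

(** Rearranging [g1 u + g2 v = g1 x + g2 y] as [g1 u - g1 x = g2 y - g2 v] separates [g1] from [g2].
    After Cauchy-Schwarz, each factor is an energy of images, which [freiman] bounds by that of
    [A]. *)
Lemma coll_pair2_energy A (g1 g2 : G -> G) : freiman A g1 -> freiman A g2 ->
  (coll (setX A A) (fun p => (g1 p.1 + g2 p.2)%R) (setX A A)
    (fun p => (g1 p.1 + g2 p.2)%R) <= energy A)%N.
Proof.
move=> F1 F2.
have -> : coll (setX A A) (fun p => (g1 p.1 + g2 p.2)%R) (setX A A)
    (fun p => (g1 p.1 + g2 p.2)%R) =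
  coll (setX A A) (fun p => (g1 p.1 - g1 p.2)%R) (setX A A)
    (fun p => (g2 p.1 - g2 p.2)%R).
  rewrite /coll.
  under eq_bigr do
    rewrite (big_setX A A (fun x y => (_ == (g1 x + g2 y)%R) : nat)).
  rewrite (big_setX A A (fun u v => \sum_(x in A) \sum_(y in A)
    ((g1 u + g2 v)%R == (g1 x + g2 y)%R)))%N.
  under [RHS]eq_bigr do
    rewrite (big_setX A A (fun x y => (_ == (g2 x - g2 y)%R) : nat)).
  rewrite (big_setX A A (fun u v => \sum_(x in A) \sum_(y in A)
    ((g1 u - g1 v)%R == (g2 x - g2 y)%R)))%N.
  apply: eq_bigr => u _; rewrite exchange_big; apply: eq_bigr => v _ /=.
  rewrite exchange_big; apply: eq_bigr => x _; apply: eq_bigr => y _ /=.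
  congr nat_of_bool; apply/eqP/eqP.
    by move=> E; apply/eqP; rewrite subr_eq addrAC eq_sym subr_eq E addrC.
  by move/eqP; rewrite subr_eq addrAC eq_sym subr_eq => /eqP <-; rewrite addrC.
have bnd g : freiman A g -> (coll (setX A A) (fun p => (g p.1 - g p.2)%R)
    (setX A A) (fun p => (g p.1 - g p.2)%R) <= energy A)%N.
  move=> F; apply: leq_sum => [[x y]]; rewrite inE /= => /andP[xA yA].
  apply: leq_sum => [[z t]]; rewrite inE /= => /andP[zA tA].
  by case: eqP => // /F -> //; rewrite eqxx.
apply: leq_sqr_anti; apply: leq_trans (coll_CS _ _ _ _) _.
by rewrite -mulnn leq_mul ?bnd.
Qed.

Lemma freimanN A g : freiman A g -> freiman A (fun x => - g x).
Proof.
move=> F x y z t xA yA zA tA E; apply: F => //.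
by apply: oppr_inj; rewrite !opprD.
Qed.

(** Moving [g3] and [g4] to the right makes this a collision count of two maps on pairs; after
    Cauchy-Schwarz the shift [c] cancels. *)
Lemma four_var_energy A (g1 g2 g3 g4 : G -> G) c :
  freiman A g1 -> freiman A g2 -> freiman A g3 -> freiman A g4 ->
  (#|[set p : (G * G) * (G * G) | [&& p.1 \in setX A A, p.2 \in setX A A &
     (g1 p.1.1 + g2 p.1.2 + g3 p.2.1 + g4 p.2.2 == c)%R]]| <= energy A)%N.
Proof.
move=> F1 F2 F3 F4.
pose f p := g1 p.1 + g2 p.2.
pose h (p : G * G) := c + ((- g3 p.1) + (- g4 p.2)).
have -> : #|[set p : (G * G) * (G * G) |
     [&& p.1 \in setX A A, p.2 \in setX A A &
     (g1 p.1.1 + g2 p.1.2 + g3 p.2.1 + g4 p.2.2 == c)%R]]|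
   = coll (setX A A) f (setX A A) h.
  rewrite -sum1dep_card /coll pair_big /= big_mkcond [RHS]big_mkcond /=.
  apply: eq_bigr => [[p q]] _ /=.
  case: (p \in _); case: (q \in _) => //=; rewrite /f /h.
  by rewrite -opprD eq_sym -[LHS]/(nat_of_bool _) -addrA [in RHS]eq_sym subr_eq.
apply: leq_sqr_anti; apply: leq_trans (coll_CS _ _ _ _) _.
rewrite -mulnn leq_mul ?coll_pair2_energy //.
apply: leq_trans (coll_pair2_energy (freimanN F3) (freimanN F4)).
apply: leq_sum => u _; apply: leq_sum => v _; rewrite /h.
by rewrite (inj_eq (addrI c)).
Qed.

End Energy.

(** * Plunnecke's inequality, after Petridis *)

Section Plunnecke.
Variable G : finZmodType.
Implicit Types A X Y Z C : {set G}.

Definition sumset X Y : {set G} := [set x + y | x in X, y in Y].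

Definition nsum A n : {set G} := iter n (sumset A) [set 0].

Lemma mem_sumset X Y x y : x \in X -> y \in Y -> x + y \in sumset X Y.
Proof. exact: imset2_f. Qed.

Lemma sumsetA X Y Z : sumset X (sumset Y Z) = sumset (sumset X Y) Z.
Proof.
apply/setP => u; apply/imset2P/imset2P => [[x _ xX /imset2P[y z yY zZ ->] ->]|].
  by exists (x + y) z; rewrite ?mem_sumset // addrA.
case=> _ z /imset2P[x y xX yY ->] zZ ->.
by exists x (y + z); rewrite ?mem_sumset // addrA.
Qed.

Lemma sumset0 X : sumset X [set 0] = X.
Proof.
apply/setP => u; apply/imset2P/idP => [[x y xX /set1P -> ->]|uX].
  by rewrite addr0.
by exists u 0; rewrite ?inE ?addr0.
Qed.

Lemma sumsetSl X Y Z : X \subset Y -> sumset X Z \subset sumset Y Z.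
Proof.
move=> /subsetP XY; apply/subsetP => _ /imset2P[x y /XY xY yZ ->].
exact: mem_sumset.
Qed.

(** The hypothesis says that [X] minimizes the ratio [|X + A| / |X|] among its nonempty subsets.
    Induct on [C], adding one element [c] to [C0]. *)
Lemma petridis X A C :
  (forall Z, Z \subset X -> #|sumset X A| * #|Z| <= #|sumset Z A| * #|X|)%N ->
  (#|sumset (sumset X A) C| * #|X| <= #|sumset X A| * #|sumset X C|)%N.
Proof.
move=> minX; have [n] := ubnP #|C|; elim: n C => // n IHn C leCn.
have [->|[c cC]] := set_0Vmem C.
  have -> : sumset (sumset X A) set0 = set0.
    by apply/setP => u; rewrite inE; apply/imset2P => [[x y _]]; rewrite inE.
  by rewrite cards0.
have [C0 C0E CE] : exists2 C0, C0 = C :\ c & C = c |: C0.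
  by exists (C :\ c); rewrite // setD1K.
have {IHn} IH : (#|sumset (sumset X A) C0| * #|X| <=
    #|sumset X A| * #|sumset X C0|)%N.
  by apply: IHn; move: leCn; rewrite (cardsD1 c) cC C0E; lia.
move: CE => {cC leCn C0E} ->.
(* [Z] collects the [x] whose translate [x + A + c] brings nothing new. So [X + A + C] gains at most
   [|X + A| - |Z + A|] points, while [X + C] gains at least [|X| - |Z|]; minimality at [Z] compares
   the two gains. *)
pose Z := [set x in X | [forall a in A, x + a + c \in sumset (sumset X A) C0]].
have ZX : Z \subset X by apply/subsetP => x; rewrite inE => /andP[].
have up : (#|sumset (sumset X A) (c |: C0)| <=
    #|sumset (sumset X A) C0| + (#|sumset X A| - #|sumset Z A|))%N.
  rewrite -(cardsDS (sumsetSl A ZX)) -(card_imset (mem (_ :\: _)) (addIr c)).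
  apply: leq_trans (leq_card_setU _ _).1; apply: subset_leq_card.
  apply/subsetP => _ /imset2P[y d yXA dC ->]; rewrite inE.
  have [yc|ycN] := boolP (y + d \in sumset (sumset X A) C0) => //=.
  move: dC; rewrite !inE => /orP[/eqP dc|dC0]; last first.
    by rewrite mem_sumset in ycN.
  subst d; apply: imset_f; rewrite inE yXA andbT.
  apply: contra ycN => /imset2P[z a]; rewrite inE.
  by move=> /andP[_ /forall_inP zA] /zA ? ->.
(* If [x + c = x' + d] with [d] in [C0], then [x + a + c = x' + a + d] for every [a], which puts [x]
   in [Z]. *)
have low : (#|sumset X C0| + (#|X| - #|Z|) <= #|sumset X (c |: C0)|)%N.
  rewrite -(cardsDS ZX) -(card_imset (mem (_ :\: _)) (addIr c)).
  rewrite -cardsUI [X in (_ + X)%N](_ : _ = 0%N) ?addn0.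
    apply: subset_leq_card; apply/subsetP => u; rewrite inE => /orP[].
      by case/imset2P => x d xX dC ->; rewrite mem_sumset // inE dC orbT.
    case/imsetP => x; rewrite inE => /andP[_ xX] ->.
    by rewrite mem_sumset // !inE eqxx.
  apply/eqP; rewrite cards_eq0; apply/eqP/setP => u; rewrite !inE.
  apply/andP => [[uXC /imsetP[x]]]; rewrite !inE => /andP[xZ xX] ux; subst u.
  move/negP: xZ; apply; rewrite xX; apply/forall_inP => a aA.
  case/imset2P: uXC => x' d xX' dC E.
  by rewrite addrAC E addrAC mem_sumset // mem_sumset.
have := minX _ ZX; have := subset_leq_card ZX.
have := subset_leq_card (sumsetSl A ZX).
move: IH up low; nia.
Qed.

(** Take a nonempty [X] in [Y] of least ratio. Then [petridis] with [C = nsum A h] shows that each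
    further summand [A] costs a factor at most [M]; a translate of [nsum A h] lies in
    [X + nsum A h]. *)
Lemma plunnecke A Y M h : Y != set0 ->
  (#|sumset Y A| <= M * #|Y|)%N -> (#|nsum A h| <= M ^ h * #|Y|)%N.
Proof.
move=> Y0 MY.
pose F X : rat := #|sumset X A|%:R / #|X|%:R.
pose P X := (X \subset Y) && (X != set0).
have PY : P Y by rewrite /P subxx.
have [X /andP[XY X0] minX] := @arg_minP _ _ _ Y P F PY.
have cX : (0 < #|X|)%N by rewrite card_gt0.
have ratio Z : Z \subset Y -> (#|sumset X A| * #|Z| <= #|sumset Z A| * #|X|)%N.
  move=> ZY; have [->|Z0] := eqVneq Z set0; first by rewrite cards0 muln0.
  have cZ : (0 < #|Z|)%N by rewrite card_gt0.
  have := minX Z; rewrite /P ZY Z0 /F => /(_ isT).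
  by rewrite ler_pdivrMr ?ltr0n // mulrAC ler_pdivlMr ?ltr0n // -!natrM ler_nat.
have MX : (#|sumset X A| <= M * #|X|)%N.
  have cY : (0 < #|Y|)%N by rewrite card_gt0.
  rewrite -(leq_pmul2r cY); apply: leq_trans (ratio Y (subxx _)) _.
  by rewrite mulnAC leq_mul2r MY orbT.
have XhA : (#|sumset X (nsum A h)| <= M ^ h * #|X|)%N.
  elim: h => [|h IH]; first by rewrite /nsum /= sumset0 mul1n.
  rewrite /nsum /= -/(nsum A h) sumsetA -(leq_pmul2r cX).
  apply: leq_trans (petridis _ _) _ => [Z ZX|].
    by apply: ratio; apply: subset_trans XY.
  apply: leq_trans (leq_mul MX IH) _; by rewrite expnS -!mulnA (mulnCA #|X|).
have [x xX] := set0Pn _ X0.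
apply: (@leq_trans #|sumset X (nsum A h)|).
  rewrite -(card_imset (mem (nsum A h)) (addrI x)); apply: subset_leq_card.
  by apply/subsetP => _ /imsetP[y yA ->]; rewrite mem_sumset.
apply: leq_trans XhA _; by rewrite leq_mul2l subset_leq_card ?orbT.
Qed.

Lemma mem_nsumD A m n x y :
  x \in nsum A m -> y \in nsum A n -> x + y \in nsum A (m + n).
Proof.
move=> xm yn; elim: m x xm => [|m IH] x.
  by rewrite /nsum /= => /set1P ->; rewrite add0r.
case/imset2P => a z aA zm ->; rewrite -addrA; apply: mem_sumset => //.
exact: IH.
Qed.

Lemma mem_nsumMn A n x : x \in A -> x *+ n \in nsum A n.
Proof.
move=> xA; elim: n => [|n IH]; first by rewrite /nsum /= set11.
by rewrite mulrS; apply: mem_sumset.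
Qed.

Lemma mem_nsum_sum A k (a : 'I_k -> nat) (x : 'I_k -> G) :
  (forall i, x i \in A) -> \sum_i x i *+ a i \in nsum A (\sum_i a i).
Proof.
move=> xA; elim/big_rec2: _ => [|i m s _ IH]; first by rewrite /nsum /= set11.
by apply: mem_nsumD => //; apply: mem_nsumMn.
Qed.

End Plunnecke.

(** * The Balog-Szemeredi-Gowers theorem *)

Section BalogSzemerediGowers.
Variables (G : finZmodType) (A : {set G}) (L : nat).

Let n := #|A|.

Definition reps (d : G) : nat := fiber (setX A A) (fun p => p.1 - p.2) d.

Definition popular (d : G) : bool := (n <= L * reps d)%N.

(** Popular differences are the edges of a bipartite graph between two copies of [A]; [codeg] below
    counts common neighbours. *)
Definition nbhd (b : G) : {set G} := [set a in A | popular (a - b)].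

Definition codeg (a a' : G) : nat :=
  #|[set b in A | popular (a - b) && popular (a' - b)]|.

(** The factor 32 is chosen so that at most one sixteenth of the pairs in the selected neighbourhood
    are bad. *)
Definition bad (a a' : G) : bool := (32 * L ^ 2 * codeg a a' < n)%N.

Definition bad_pairs (B : {set G}) : {set G * G} :=
  [set p in setX B B | bad p.1 p.2].

Lemma sum_reps : (\sum_d reps d = n ^ 2)%N.
Proof. by rewrite sum_fiber cardsX mulnn. Qed.

Lemma reps_le d : (reps d <= n)%N.
Proof.
rewrite /reps fiberE -(@card_in_imset _ _ (fun p => p.2)).
  apply: subset_leq_card; apply/subsetP => _ /imsetP[p + ->].
  by rewrite !inE => /andP[/andP[]].
move=> [x y] [x' y']; rewrite !inE /= => /andP[_ /eqP E] /andP[_ /eqP E'] yy.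
by rewrite -yy in E' *; congr (_, _); apply: (@addIr _ (- y)); rewrite E E'.
Qed.

Lemma card_popular : (0 < n)%N -> (#|[set d | popular d]| <= L * n)%N.
Proof.
move=> n0; rewrite -(leq_pmul2r n0) -sum_nat_const -mulnA mulnn -sum_reps.
rewrite big_distrr /= big_mkcond; apply: leq_sum => d _; rewrite inE.
by case: ifP.
Qed.

Lemma sum_nbhd : (\sum_(b in A) #|nbhd b| = \sum_(d | popular d) reps d)%N.
Proof.
transitivity (\sum_(b in A) \sum_(a in A) popular (a - b)%R)%N.
  apply: eq_bigr => b _; rewrite -sum1dep_card big_mkcondr /=.
  by apply: eq_bigr => a _; case: popular.
rewrite exchange_big -(big_setX A A (fun x y => popular (x - y) : nat)) /=.
rewrite /reps /fiber exchange_big /=; apply: eq_bigr => p _.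
have [pp|/negPf pN] := boolP (popular _).
  rewrite (bigD1 (p.1 - p.2)) //= eqxx big1 ?addn0 // => d /andP[_ /negPf].
  by rewrite eq_sym => ->.
by rewrite big1 // => d pd; case: eqP => // E; rewrite E pd in pN.
Qed.

(** Unpopular differences contribute at most [n^3 / L], half of the guaranteed energy since
    [L = 2K]. The popular ones carry the rest, and each has at most [n] representations. *)
Lemma popular_mass K : L = (2 * K)%N -> (0 < n)%N ->
  (n ^ 3 <= K * energy A)%N ->
  (n ^ 2 <= L * \sum_(b in A) #|nbhd b|)%N.
Proof.
move=> LK n0; rewrite /energy coll_fiber -/reps sum_nbhd => E.
rewrite -(leq_pmul2l n0).
have : (2 * n ^ 3 <= n * (L * (\sum_(d | popular d) reps d)) + n * n ^ 2)%N.
  apply: (@leq_trans (L * (\sum_w reps w * reps w))%N); first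
    by rewrite LK -mulnA leq_mul2l.
  rewrite -sum_reps (bigID popular) /= mulnDr !big_distrr /=; apply: leq_add.
    by apply: leq_sum => d _; rewrite mulnCA leq_mul2r reps_le orbT.
  rewrite big_mkcond; apply: leq_sum => d _.
  case: ifP => //; rewrite -ltnNge => /ltnW lt.
  by rewrite mulnA leq_mul2r lt orbT.
by rewrite -expnS mul2n -addnn leq_add2r.
Qed.

(** Double counting: a pair lies in [nbhd b] for exactly [codeg] many [b], and there are at most
    [n^2] pairs. *)
Lemma sum_bad :
  (32 * L ^ 2 * \sum_(b in A) #|bad_pairs (nbhd b)| <= n ^ 3)%N.
Proof.
have -> : (\sum_(b in A) #|bad_pairs (nbhd b)| =
  \sum_(p in setX A A | bad p.1 p.2) codeg p.1 p.2)%N.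
  under [RHS]eq_bigr do rewrite /codeg -sum1dep_card big_mkcondr.
  rewrite exchange_big /=; apply: eq_bigr => b bA.
  rewrite -sum1dep_card big_mkcond [RHS]big_mkcond; apply: eq_bigr => p _ /=.
  rewrite !inE; case: (p.1 \in A); case: (p.2 \in A); case: (bad _ _);
    by case: popular; case: popular.
rewrite big_distrr /=; apply: (@leq_trans (\sum_(p in setX A A) n)%N).
  rewrite big_mkcondr; apply: leq_sum => p _; case: ifP => // /ltnW //.
by rewrite sum_nat_const cardsX expnSr -mulnn.
Qed.

(* Dependent random choice: the inequality holds on average over [b]. *)
Lemma good_nbhd K : L = (2 * K)%N -> (0 < n)%N -> (n ^ 3 <= K * energy A)%N ->
  exists2 b, b \in A &
    (n ^ 2 + 32 * L ^ 2 * #|bad_pairs (nbhd b)| <= 2 * L ^ 2 * #|nbhd b| ^ 2)%N.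
Proof.
move=> LK n0 E.
have pm := popular_mass LK n0 E.
have cs : ((\sum_(b in A) #|nbhd b|) ^ 2 <= n * \sum_(b in A) #|nbhd b| ^ 2)%N.
  have := sum_nat_CS (mem A) (fun=> 1%N) (fun b => #|nbhd b|).
  by rewrite /= sum_nat_const muln1; under eq_bigr do rewrite mul1n.
have s2 : (n ^ 3 <= L ^ 2 * \sum_(b in A) #|nbhd b| ^ 2)%N.
  rewrite -(leq_pmul2l n0) -expnS (expnM n 2 2) mulnCA.
  apply: leq_trans (leq_mul (leqnn (L ^ 2)) cs).
  by rewrite -expnMn leq_exp2r.
pose ok b := (n ^ 2 + 32 * L ^ 2 * #|bad_pairs (nbhd b)|
  <= 2 * L ^ 2 * #|nbhd b| ^ 2)%N.
have [/exists_inP //|] := boolP [exists b in A, ok b].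
rewrite negb_exists => /forallP H.
(* Failure at every [b] sums to [2 L^2 * \sum #|nbhd b|^2 < n^3 + n^3] by [sum_bad], against
   [s2]. *)
have : (\sum_(b in A) 2 * L ^ 2 * #|nbhd b| ^ 2 <
   \sum_(b in A) (n ^ 2 + 32 * L ^ 2 * #|bad_pairs (nbhd b)|))%N.
  have [b bA] : exists b, b \in A by apply/set0Pn; rewrite -card_gt0.
  rewrite (bigD1 b) //= [ltnRHS](bigD1 b) //= -addSn leq_add //.
    by have := H b; rewrite bA /= -ltnNge.
  by apply: leq_sum => c /andP[cA _]; have := H c; rewrite cA -ltnNge => /ltnW.
rewrite big_split /= sum_nat_const -big_distrr /= -!big_distrr /=.
rewrite -expnS -/n => lt; exfalso; move: lt s2 sum_bad.
rewrite -(mulnA 2) -/n; set S := (L ^ 2 * _)%N; set T := (32 * _ * _)%N.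
by clear; lia.
Qed.


(** With the threshold one quarter, any two members leave at least half of [B] that is bad with
    neither. *)
Definition good_part (B : {set G}) : {set G} :=
  [set a in B | 4 * #|[set a' in B | bad a a']| <= #|B|]%N.

(** Markov's inequality: each discarded element has more than [#|B| / 4] bad partners. *)
Lemma card_good_part (B : {set G}) :
  (16 * #|bad_pairs B| <= #|B| ^ 2 ->
   3 * #|B| <= 4 * #|good_part B|)%N.
Proof.
have [->|B0] := eqVneq B set0; first by rewrite cards0.
have b0 : (0 < #|B|)%N by rewrite card_gt0.
have -> : #|bad_pairs B| =
    (\sum_(a in B) #|[set a' in B | bad a a']|)%N.
  rewrite -sum1dep_card big_mkcondr.
  rewrite (big_setX B B (fun x y => if bad x y then 1 else 0)%N).
  by apply: eq_bigr => a _; rewrite -sum1dep_card big_mkcondr.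
have GB : good_part B \subset B by apply/subsetP => x; rewrite inE => /andP[].
have : (#|B :\: good_part B| * #|B| <=
    4 * \sum_(a in B) #|[set a' in B | bad a a']|)%N.
  rewrite -sum_nat_const big_distrr /= big_mkcond [leqRHS]big_mkcond /=.
  apply: leq_sum => a _; rewrite !inE;
  case: (a \in B) => //=; rewrite ?andbF // andbT.
  by case: ifP => //; rewrite -ltnNge => /ltnW.
rewrite cardsDS //; have := subset_leq_card GB.
set s := (\sum_(_ in _) _)%N; clearbody s; move: b0; clear; nia.
Qed.

Lemma codeg_good a a' : ~~ bad a a' -> (n <= 32 * L ^ 2 * codeg a a')%N.
Proof. by rewrite -leqNgt. Qed.

Lemma bad_sym a a' : bad a a' = bad a' a.
Proof.
rewrite /bad /codeg; congr (_ * _ < _)%N; apply: eq_card => b.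
by rewrite !inE [popular _ && _]andbC.
Qed.

Let P := [set d | popular d].

Definition rep4 (d : G) : {set (G * G) * (G * G)} :=
  [set q in setX (setX P P) (setX P P) | q.1.1 - q.1.2 + (q.2.1 - q.2.2) == d].

(* Writes [a - a'] as [(a - b) - (c - b) + (c - b') - (a' - b')] with four
   popular differences. *)
Lemma rep4_lower (B : {set G}) a a' :
  B \subset A -> a \in good_part B -> a' \in good_part B ->
  (#|B| * n ^ 2 <= 2 * (32 * L ^ 2) ^ 2 * #|rep4 (a - a')%R|)%N.
Proof.
move=> BA; rewrite !inE => /andP[aB ga] /andP[aB' ga'].
pose S (c : G) : {set (G * G)} :=
  setX [set b in A | popular (a - b) && popular (c - b)]
       [set b in A | popular (c - b) && popular (a' - b)].
pose T : {set G * (G * G)} := [set t | (t.1 \in B) && (t.2 \in S t.1)].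
pose C := [set c in B | ~~ bad a c && ~~ bad a' c].
have cC : (#|B| <= 2 * #|C|)%N.
  have : (#|B| <=
      #|[set c in B | bad a c]| + #|[set c in B | bad a' c]| + #|C|)%N.
    apply: leq_trans (leq_add (leq_card_setU _ _).1 (leqnn _)).
    apply: leq_trans (leq_card_setU _ _).1; apply: subset_leq_card.
    by apply/subsetP => c cB; rewrite !inE cB /=; do 2 case: bad.
  lia.
(* Each intermediate [c] allows [codeg a c * codeg c a'] choices of [(b, b')], both factors being at
   least [n / (32 L^2)]. *)
have cT : (#|C| * n ^ 2 <= (32 * L ^ 2) ^ 2 * #|T|)%N.
  have -> : #|T| = (\sum_(c in B) codeg a c * codeg c a')%N.
    rewrite -sum1dep_card.
    rewrite -(pair_big_dep (mem B) (fun c t => t \in S c) (fun _ _ => 1%N)) /=.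
    by apply: eq_bigr => c _; rewrite sum1_card cardsX.
  rewrite -sum_nat_const big_distrr /= big_mkcond [leqRHS]big_mkcond /=.
  apply: leq_sum => c _; rewrite inE; case: (c \in B) => //=.
  case: ifP => // /andP[/codeg_good h1]; rewrite bad_sym => /codeg_good h2.
  by rewrite -!mulnn mulnACA leq_mul.
have T4 : (#|T| <= #|rep4 (a - a')%R|)%N.
  pose f (t : G * (G * G)) :=
    ((a - t.2.1, t.1 - t.2.1), (t.1 - t.2.2, a' - t.2.2)).
  rewrite -(@card_in_imset _ _ f).
    apply: subset_leq_card; apply/subsetP => _ /imsetP[[c [b b']] + ->].
    rewrite !inE /= => /and3P[cB /and3P[_ -> ->] /and3P[_ -> ->]] /=.
    by rewrite !opprB !addrA !subrK.
  move=> [c [b b']] [c1 [b1 b1']] _ _.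
  by case=> /addrI/oppr_inj <- /addIr <- /addrI/oppr_inj <-.
rewrite (leq_trans (_ : _ <= 2 * (#|C| * n ^ 2))%N) //.
  by rewrite mulnA leq_mul2r cC orbT.
by rewrite -mulnA leq_mul2l (leq_trans cT) // leq_mul2l T4 orbT.
Qed.

End BalogSzemerediGowers.

(** Every difference of [A'] has many representations by four popular differences, by [rep4_lower],
    while at most [(L n)^4] quadruples of these exist. Hence there are few differences. *)
Theorem balog_szemeredi_gowers (G : finZmodType) (A : {set G}) K :
  (0 < #|A|)%N -> (#|A| ^ 3 <= K * energy A)%N ->
  exists A' : {set G}, [/\ A' \subset A, (#|A| <= 8 * K * #|A'|)%N &
    (#|sumset [set - x | x in A'] A'| <= 2 ^ 14 * (2 * K) ^ 10 * #|A'|)%N].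
Proof.
move=> A0 E; have [L LK] : {L | L = (2 * K)%N} by exists (2 * K)%N.
have K0 : (0 < K)%N by case: K E {LK} => //; rewrite mul0n leqn0 expn_eq0; lia.
have [b bA hb] := good_nbhd LK A0 E.
set B := nbhd A L b in hb; set n := #|A| in A0 E hb *.
have BA : B \subset A by apply/subsetP => x; rewrite inE => /andP[].
have L2 : (0 < 2 * L ^ 2)%N by rewrite muln_gt0 expn_gt0 LK muln_gt0 K0.
have nB : (n <= 2 * L * #|B|)%N.
  apply: leq_sqr_anti; apply: leq_trans (leq_addr _ _) (leq_trans hb _).
  by rewrite !expnMn -!mulnA leq_mul2l leq_pmull.
have badB : (16 * #|bad_pairs A L B| <= #|B| ^ 2)%N.
  rewrite -(leq_pmul2l L2); apply: leq_trans hb.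
  apply: leq_trans (leq_addl _ _).
  by rewrite mulnCA !mulnA.
have cA' := card_good_part badB.
set A' := good_part A L B in cA'; exists A'.
have A'B : A' \subset B by apply/subsetP => x; rewrite inE => /andP[].
have nA' : (n <= 4 * L * #|A'|)%N.
  rewrite (leq_trans nB) // -!mulnA !(mulnCA _ L) leq_mul2l; lia.
split; first exact: subset_trans A'B BA.
  by rewrite (leq_trans nA') // LK mulnA.
set D := sumset _ _.
pose P := [set d | popular A L d].
have cP : (#|P| <= L * n)%N by apply: card_popular.
have sumD : (\sum_(d in D) #|rep4 A L d| <= #|P| ^ 4)%N.
  have -> : (#|P| ^ 4 = #|setX (setX P P) (setX P P)|)%N.
    by rewrite !cardsX; lia.
  rewrite -(sum_fiber _ (fun q : (G * G) * (G * G) =>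
    (q.1.1 - q.1.2 + (q.2.1 - q.2.2))%R)).
  rewrite big_mkcond; apply: leq_sum => d _.
  by case: ifP => // _; rewrite fiberE.
have lowD : (#|D| * (#|B| * n ^ 2) <= 2 * (32 * L ^ 2) ^ 2 * #|P| ^ 4)%N.
  apply: leq_trans (leq_mul (leqnn _) sumD).
  rewrite -sum_nat_const big_distrr /=; apply: leq_sum => d.
  case/imset2P => _ x /imsetP[y yA' ->] xA' ->.
  by rewrite addrC; apply: rep4_lower.
have B0 : (0 < #|B|)%N by rewrite lt0n; apply: contraTneq nB => ->; lia.
have DB : (#|D| * #|B| <= 2 ^ 11 * L ^ 8 * n ^ 2)%N.
  have n2 : (0 < n ^ 2)%N by rewrite expn_gt0 A0.
  rewrite -(leq_pmul2r n2) -mulnA (leq_trans lowD) //.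
  apply: leq_trans (leq_mul (leqnn _) (_ : _ <= (L * n) ^ 4)%N) _.
    by rewrite leq_exp2r.
  by apply/eq_leq; rewrite !expnMn; lia.
(* Trading [#|B|] for [n] costs a factor [2 L]; trading [n] for [#|A'|] afterwards costs [4 L],
   whence the exponents 14 and 10. *)
have Dn : (#|D| <= 2 ^ 12 * L ^ 9 * n)%N.
  rewrite -(leq_pmul2r B0) (leq_trans DB) //.
  rewrite -mulnn; move: nB; rewrite -(leq_pmul2l A0) => h.
  apply: leq_trans (leq_mul (leqnn _) h) _.
  by apply/eq_leq; rewrite [(L ^ 9)%N]expnS; lia.
rewrite (leq_trans Dn) //; apply: leq_trans (leq_mul (leqnn _) nA') _.
by apply/eq_leq; rewrite -LK [(L ^ 10)%N]expnS; lia.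
Qed.

(** * Counting solutions *)

Lemma four_more_indices (I : finType) (p q : I) : p != q -> (6 <= #|I|)%N ->
  exists i1 i2 i3 i4, uniq [:: p; q; i1; i2; i3; i4].
Proof.
move=> pq I6.
have s4 : (4 <= size (enum (predC (pred2 p q))))%N.
  rewrite -cardE -(leq_add2l #|pred2 p q|) cardC card2 pq; exact: I6.
have := enum_uniq (predC (pred2 p q)); have := mem_enum (predC (pred2 p q)).
case: (enum _) s4 => [|i1 [|i2 [|i3 [|i4 s]]]] // _ Es Us.
exists i1, i2, i3, i4.
have N i : i \in [:: i1, i2, i3, i4 & s] -> (i != p) && (i != q).
  by rewrite Es !inE negb_or.
have U4 : uniq [:: i1; i2; i3; i4].
  by have : uniq ([:: i1; i2; i3; i4] ++ s) := Us; rewrite cat_uniq => /and3P[].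
have /andP[p1 q1] := N i1 ltac:(by rewrite !inE eqxx).
have /andP[p2 q2] := N i2 ltac:(by rewrite !inE eqxx !orbT).
have /andP[p3 q3] := N i3 ltac:(by rewrite !inE eqxx !orbT).
have /andP[p4 q4] := N i4 ltac:(by rewrite !inE eqxx !orbT).
rewrite 2!cons_uniq U4 andbT !inE !negb_or pq.
by rewrite ![p == _]eq_sym ![q == _]eq_sym p1 p2 p3 p4 q1 q2 q3 q4.
Qed.

(** * Solutions with two equal variables *)

Section Degenerate.
Variable G : finZmodType.
Implicit Types A : {set G}.

Lemma energy_le A : (energy A <= #|A| ^ 3)%N.
Proof.
rewrite /energy coll_fiber [(_ ^ 3)%N]expnS -(sum_reps A) big_distrr /=.
by apply: leq_sum => d _; rewrite leq_mul2r reps_le orbT.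
Qed.

Definition sols (I : finType) A (g : I -> G -> G) : {set {ffun I -> G}} :=
  [set x in ffun_on (mem A) | \sum_i g i (x i) == 0].

(** Fix all variables except [q] and four others, keeping [p] among the fixed ones. Then [x q = x p]
    is known, and [four_var_energy] counts the remaining four. The merged coefficient may vanish, so
    [p] and [q] stay outside these four. *)
Lemma card_sols_merge (I : finType) A (g : I -> G -> G) p q :
  p != q -> (6 <= #|I|)%N -> (forall i, freiman A (g i)) ->
  (#|[set x in sols A g | x p == x q]| <= #|A| ^ (#|I| - 5) * energy A)%N.
Proof.
move=> pq I6 Fg.
have [i1 [i2 [i3 [i4 U]]]] := four_more_indices pq I6.
pose J := [pred i |
  (i != q) && (i != i1) && (i != i2) && (i != i3) && (i != i4)].
have U5 : uniq [:: q; i1; i2; i3; i4] by move: U => /andP[].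
have Jp : J p.
  move: U => /andP[]; rewrite !inE !negb_or => /and5P[h0 h1 h2 h3 h4] _.
  by rewrite h0 h1 h2 h3 h4.
have cJ : #|J| = (#|I| - 5)%N.
  have -> : #|J| = #|predC (mem [:: q; i1; i2; i3; i4])|.
    by apply: eq_card => i; rewrite !inE !negb_or !andbA.
  by rewrite -(cardC (mem [:: q; i1; i2; i3; i4])) (card_uniqP U5) addKn.
have split5 (F : I -> G) : \sum_i F i =
    F i1 + F i2 + F i3 + F i4 + (\sum_(i | J i) F i + F q).
  move: U5 => /=; rewrite !inE !negb_or.
  case/and5P => /and4P[a1 a2 a3 a4] /and3P[b2 b3 b4] /andP[c3 c4] d4 _.
  rewrite (bigD1 q) //= (bigD1 i1) /= 1?eq_sym ?a1 //.
  rewrite (bigD1 i2) /= 1?eq_sym ?a2 1?eq_sym ?b2 //.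
  rewrite (bigD1 i3) /= 1?eq_sym ?a3 1?eq_sym ?b3 1?eq_sym ?c3 //.
  rewrite (bigD1 i4) /= 1?eq_sym ?a4 1?eq_sym ?b4 1?eq_sym ?c4 1?eq_sym ?d4 //.
  by rewrite addrC !addrA.
(* The default value 0 off [J] makes the restriction an element of [pffun_on], whose cardinality is
   known. *)
pose phi (x : {ffun I -> G}) :=
  ([ffun i => if J i then x i else 0], ((x i1, x i2), (x i3, x i4))).
pose c (z : {ffun I -> G}) := - (\sum_(i | J i) g i (z i) + g q (z p)).
pose Q (z : {ffun I -> G}) := [set y : (G * G) * (G * G) |
  [&& y.1 \in setX A A, y.2 \in setX A A &
     (g i1 y.1.1 + g i2 y.1.2 + g i3 y.2.1 + g i4 y.2.2 == c z)%R]].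
pose T := [set u : {ffun I -> G} * ((G * G) * (G * G)) |
   (u.1 \in pffun_on 0 J (mem A)) && (u.2 \in Q u.1)].
have cT : (#|T| <= #|A| ^ (#|I| - 5) * energy A)%N.
  rewrite -sum1dep_card -(pair_big_dep (mem (pffun_on 0 J (mem A)))
    (fun c t => t \in Q c) (fun _ _ => 1%N)) /=.
  rewrite -cJ -(card_pffun_on (0 : G) J) -sum_nat_const; apply: leq_sum => z _.
  by rewrite sum1_card four_var_energy.
apply: leq_trans cT; rewrite -(@card_in_imset _ _ phi).
  apply: subset_leq_card; apply/subsetP => _ /imsetP[x + ->].
  rewrite !inE => /andP[/andP[/ffun_onP xA /eqP xs] /eqP xpq].
  rewrite /= !xA /=; apply/andP; split.
    apply/pffun_onP; split.
      by apply/subsetP => i; rewrite !inE ffunE; case: ifP => //; rewrite eqxx.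
    move=> _ /imageP[i iJ ->]; rewrite ffunE; move: iJ; rewrite inE => ->.
    exact: xA.
  have /= Jp' := Jp; rewrite -subr_eq0 /c opprK ffunE Jp' xpq.
  apply/eqP; rewrite -[RHS]xs split5; congr (_ + (_ + _)).
  by apply: eq_bigr => i /= Ji; rewrite ffunE Ji.
move=> x y; rewrite !inE => /andP[_ /eqP xpq] /andP[_ /eqP ypq] [E e1 e2 e3 e4].
have EJ i : J i -> x i = y i.
  by move=> /= Ji; move/ffunP: E => /(_ i); rewrite !ffunE /= Ji.
apply/ffunP => i; have [/EJ //|] := boolP (J i).
rewrite /= !negb_and !negbK -!orbA.
case/or4P => [/eqP ->|/eqP ->|/eqP ->|/orP[]/eqP ->] //.
by rewrite -xpq -ypq EJ.
Qed.

Lemma card_sols_noninj (I : finType) A (g : I -> G -> G) :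
  (6 <= #|I|)%N -> (forall i, freiman A (g i)) ->
  (forall x, x \in sols A g -> ~~ injectiveb x) ->
  (#|sols A g| <= #|I| ^ 2 * (#|A| ^ (#|I| - 5) * energy A))%N.
Proof.
move=> I6 Fg ninj.
apply: (@leq_trans (\sum_(x in sols A g)
  \sum_(t : I * I | t.1 != t.2) (x t.1 == x t.2))%N).
  rewrite -sum1_card; apply: leq_sum => x /ninj /injectivePn[p [q pq xpq]].
  by rewrite (bigD1 (p, q)) //= xpq eqxx.
rewrite exchange_big /= -mulnn -card_prod -sum_nat_const /=.
rewrite big_mkcond; apply: leq_sum => [[p q]] _ /=; case: ifP => // pq.
apply: leq_trans (card_sols_merge pq I6 Fg).
rewrite -[leqRHS]sum1dep_card [leqRHS]big_mkcondr.
by apply: leq_sum => x _; case: eqP.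
Qed.

End Degenerate.

(** * The size bound in a finite abelian group *)

Section Core.
Variables (G : finZmodType) (k : nat) (a : 'I_k -> nat).
Implicit Types A : {set G}.

Definition signed_dilate (i : 'I_(k + k)) (y : G) : G :=
  match split i with inl j => y *+ a j | inr j => - (y *+ a j) end.

Lemma sum_signed_dilate (x : 'I_(k + k) -> G) :
  \sum_i signed_dilate i (x i) =
  \sum_i x (lshift k i) *+ a i - \sum_i x (rshift k i) *+ a i.
Proof.
rewrite big_split_ord -sumrN; congr (_ + _); apply: eq_bigr => i _.
  by rewrite /signed_dilate (unsplitK (inl i)).
by rewrite /signed_dilate (unsplitK (inr i)).
Qed.

(** Solutions are the collisions of the linear form on [A^k], whose values lie in [H]. It serves
    once with the whole group and once with an iterated sumset as [H]. *)
Lemma card_sols_ge A (H : {set G}) :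
  (forall x : 'I_k -> G, (forall i, x i \in A) -> \sum_i x i *+ a i \in H) ->
  ((#|A| ^ k) ^ 2 <= #|H| * #|sols A signed_dilate|)%N.
Proof.
move=> AH; pose P := [set x : {ffun 'I_k -> G} in ffun_on (mem A)].
pose f (x : {ffun 'I_k -> G}) := \sum_i x i *+ a i.
have -> : (#|A| ^ k = #|P|)%N by rewrite cardsE card_ffun_on card_ord.
have fH : {in P, forall u, f u \in H}.
  by move=> u; rewrite inE => /ffun_onP; apply: (AH u).
apply: leq_trans (card_CS fH) _; rewrite leq_mul2l; apply/orP; right.
have -> : coll P f P f = #|[set t in setX P P | f t.1 == f t.2]|.
  rewrite /coll pair_big /= -sum1dep_card [RHS]big_mkcondr; apply: eq_big => t.
    by rewrite !inE.
  by case: eqP.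
pose j (t : {ffun 'I_k -> G} * {ffun 'I_k -> G}) : {ffun 'I_(k + k) -> G} :=
  [ffun i => match split i with inl i => t.1 i | inr i => t.2 i end].
have jl t i : j t (lshift k i) = t.1 i by rewrite ffunE (unsplitK (inl i)).
have jr t i : j t (rshift k i) = t.2 i by rewrite ffunE (unsplitK (inr i)).
rewrite -(@card_in_imset _ _ j).
  apply: subset_leq_card; apply/subsetP => _ /imsetP[[x y] + ->].
  rewrite !inE /= => /andP[/andP[/ffun_onP xA /ffun_onP yA] fxy].
  apply/andP; split; first by apply/ffun_onP => i; rewrite ffunE; case: split.
  rewrite sum_signed_dilate subr_eq0; apply/eqP; move/eqP: fxy; rewrite /f.
  under [X in _ -> X = _]eq_bigr do rewrite jl.
  by under [X in _ -> _ = X]eq_bigr do rewrite jr.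
move=> [x y] [x' y'] _ _ E; congr (_, _); apply/ffunP => i.
  by have := jl (x, y) i; rewrite E jl.
by have := jr (x, y) i; rewrite E jr.
Qed.

Lemma freiman_signed A : (forall i, freiman A (fun y => y *+ a i)) ->
  forall i, freiman A (signed_dilate i).
Proof.
move=> F i; rewrite /signed_dilate; case: (split i) => j; first exact: F.
exact: freimanN.
Qed.

Lemma freiman_sub A A' g : A' \subset A -> freiman A g -> freiman A' g.
Proof. by move=> /subsetP s F x y z t /s xA /s yA /s zA /s tA; apply: F. Qed.

Theorem card_sol_free_le A K : (3 <= k)%N -> (0 < #|A|)%N ->
  (forall i, freiman A (fun y => y *+ a i)) ->
  (forall x, x \in sols A signed_dilate -> ~~ injectiveb x) ->
  ((k + k) ^ 2 * #|G| <= K * #|A| ^ 2)%N ->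
  (#|A| <= 8 * K * ((k + k) ^ 2 * (2 ^ 14 * (2 * K) ^ 10) ^ (\sum_i a i)))%N.
Proof.
move=> k3 A0 FA ninj HK; set h := (\sum_i a i)%N.
have I6 : (6 <= #|'I_(k + k)|)%N by rewrite card_ord; lia.
have up (A' : {set G}) : A' \subset A ->
   (#|sols A' signed_dilate| <=
    (k + k) ^ 2 * (#|A'| ^ (k + k - 5) * energy A'))%N.
  move=> sA; have := @card_sols_noninj G 'I_(k + k) A' signed_dilate I6.
  rewrite card_ord; apply.
    by apply: freiman_signed => i; apply: freiman_sub sA _.
  move=> x xs; apply: ninj; move: xs; rewrite !inE => /andP[/ffun_onP xA ->].
  by rewrite andbT; apply/ffun_onP => i; apply: (subsetP sA).
have ek m : ((m ^ k) ^ 2 = m ^ (k + k - 5) * m ^ 5)%N.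
  by rewrite -expnM -expnD; congr (_ ^ _)%N; lia.
have pos m j : (0 < m -> 0 < m ^ j)%N by rewrite expn_gt0 => ->.
have E : (#|A| ^ 3 <= K * energy A)%N.
  have := @card_sols_ge A setT (fun _ _ => in_setT _); rewrite cardsT ek => h1.
  have {h1} h2 := leq_trans h1 (leq_mul (leqnn _) (up A (subxx _))).
  have {h2} h3 : (#|A| ^ 5 <= (k + k) ^ 2 * #|G| * energy A)%N.
    rewrite -(leq_pmul2l (pos _ (k + k - 5)%N A0)) (leq_trans h2) //.
    by apply/eq_leq; move: (_ ^ (k + k - 5))%N => u; clear; ring.
  rewrite -(leq_pmul2l (pos _ 2 A0)) -expnD (leq_trans h3) // mulnA leq_mul2r.
  by rewrite [(_ ^ 2 * K)%N]mulnC HK orbT.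
have [A' [sA nA' DA']] := balog_szemeredi_gowers A0 E.
set M := (2 ^ 14 * _)%N in DA' *.
have A'0 : (0 < #|A'|)%N.
  by rewrite lt0n; apply: contraTneq nA' => ->; rewrite muln0 -ltnNge.
have cN : #|[set - x | x in A']| = #|A'|.
  by rewrite card_imset //; apply: oppr_inj.
(* Plunnecke is applied with [Y = -A'], so that [Y + A'] is the difference set. *)
have PA : (#|nsum A' h| <= M ^ h * #|A'|)%N.
  by rewrite -cN; apply: plunnecke; rewrite ?cN // -card_gt0 cN.
have := @card_sols_ge A' (nsum A' h) (fun x => @mem_nsum_sum G A' k a x).
rewrite ek => h1.
(* The trivial bound [energy_le] suffices here: after cancellation, [#|A'| <= (2k)^2 M^h]
   remains. *)
have h2 := leq_trans h1 (leq_mul PA (leq_trans (up A' sA)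
  (leq_mul (leqnn _) (leq_mul (leqnn _) (energy_le A'))))).
rewrite (leq_trans nA') // leq_mul2l; apply/orP; right.
rewrite -(leq_pmul2l (pos _ (k + k - 5)%N A'0)) -(leq_pmul2l (pos _ 4 A'0)).
have -> : (#|A'| ^ 4 * (#|A'| ^ (k + k - 5) * #|A'|) =
    #|A'| ^ (k + k - 5) * #|A'| ^ 5)%N.
  by rewrite (expnS _ 4); move: (_ ^ (k + k - 5))%N => u; clear; lia.
apply: leq_trans h2 _; apply/eq_leq.
by rewrite (expnS _ 3); move: (_ ^ (k + k - 5))%N (M ^ h)%N => u v; clear; lia.
Qed.

End Core.

(** * From integers to cyclic groups *)

Lemma Zp_nat_inj M m n : (1 < M)%N -> (m < M)%N -> (n < M)%N ->
  (m%:R : 'Z_M) = n%:R -> m = n.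
Proof.
by move=> M1 mM nM /(congr1 val) /=; rewrite !val_Zp_nat // !modn_small.
Qed.

Lemma abs_le_l1norm k (a : 'I_k -> int) i : (`|a i| <= l1norm a)%N.
Proof. by rewrite /l1norm (bigD1 i) //= leq_addr. Qed.

(** Allows the coefficients to be replaced by their absolute values, as natural multiples are what
    [nsum] handles. *)
Definition swap_sign k (a : 'I_k -> int) (i : 'I_(k + k)) : 'I_(k + k) :=
  match split i with
  | inl j => if a j < 0 then rshift k j else lshift k j
  | inr j => if a j < 0 then lshift k j else rshift k j
  end.

Lemma swap_signl k (a : 'I_k -> int) j :
  swap_sign a (lshift k j) = if a j < 0 then rshift k j else lshift k j.
Proof. by rewrite /swap_sign (unsplitK (inl j)). Qed.

Lemma swap_signr k (a : 'I_k -> int) j :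
  swap_sign a (rshift k j) = if a j < 0 then lshift k j else rshift k j.
Proof. by rewrite /swap_sign (unsplitK (inr j)). Qed.

Lemma swap_signK k (a : 'I_k -> int) : involutive (swap_sign a).
Proof.
move=> i; rewrite -(splitK i); case: (split i) => j /=.
  by rewrite swap_signl; case: ifP => h; rewrite ?swap_signr ?swap_signl h.
by rewrite swap_signr; case: ifP => h; rewrite ?swap_signr ?swap_signl h.
Qed.

(* Exchanging [x_i] and [x_(k+i)] amounts to changing the sign of [a_i]. *)
Lemma symmetric_solution_swap k (a : 'I_k -> int) (w : 'I_(k + k) -> nat) :
  (\sum_i w (lshift k i) * `|a i| = \sum_i w (rshift k i) * `|a i|)%N ->
  symmetric_solution a (fun i => (w (swap_sign a i))%:Z).
Proof.
move=> E; rewrite /symmetric_solution -subr_eq0 -sumrB.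
have /eqP : \sum_i ((w (lshift k i) * `|a i|)%N%:Z -
    (w (rshift k i) * `|a i|)%N%:Z) = 0.
  apply/eqP; rewrite sumrB subr_eq0; apply/eqP; move/(congr1 Posz): E.
  by rewrite !(big_morph Posz PoszD (erefl 0%:Z)).
congr (_ == 0); apply: eq_bigr => i _; rewrite swap_signl swap_signr.
case: ifP => h; lia.
Qed.

Lemma free_set_bound k (a : 'I_k -> int) N (A : {set 'I_N.+1}) K :
  (3 <= k)%N -> (forall i, a i <> 0) -> (0 < #|A|)%N ->
  ~~ has_distinct_solution a A ->
  ((k + k) ^ 2 * (2 * l1norm a * N).+2 <= K * #|A| ^ 2)%N ->
  (#|A| <= 8 * K * ((k + k) ^ 2 * (2 ^ 14 * (2 * K) ^ 10) ^ l1norm a))%N.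
Proof.
move=> k3 a0 A0 free HK; set h := l1norm a in HK *.
(* Sums of two products [x * b i] are at most [2 h N < M], so congruences lift to equalities; the
   form [.+2] gives [1 < M]. *)
pose M := (2 * h * N).+2; pose b i := `|a i|%N.
have b0 i : (0 < b i)%N by rewrite absz_gt0; apply/eqP.
have bh i : (b i <= h)%N by apply: abs_le_l1norm.
have h0 : (0 < h)%N by apply: leq_trans (bh (Ordinal (ltnW (ltnW k3)))).
pose io (x : 'I_N.+1) : 'Z_M := (x : nat)%:R.
have lt_ord (x : 'I_N.+1) : (x <= N)%N by rewrite -ltnS.
have io_inj : injective io.
  move=> x y /Zp_nat_inj E; apply: val_inj; apply: E => //.
    by have := lt_ord x; rewrite /M; nia.
  by have := lt_ord y; rewrite /M; nia.
have cA : #|io @: A| = #|A| by rewrite card_imset.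
rewrite -cA /h; apply: (@card_sol_free_le 'Z_M k b) => //; rewrite ?cA //.
- move=> i x0 y0 z0 t0 /imsetP[x xA ->] /imsetP[y yA ->].
  move=> /imsetP[z zA ->] /imsetP[t tA ->] /eqP.
  rewrite subr_eq addrAC eq_sym subr_eq -!mulrnA -!natrD => /eqP/Zp_nat_inj E.
  have {}E : (z * b i + y * b i = x * b i + t * b i)%N.
    have := bh i; have := lt_ord x; have := lt_ord y; have := lt_ord z.
    by have := lt_ord t; move=> *; apply: E => //; rewrite /M; nia.
  have {}E : (z + y = x + t)%N by have := b0 i; nia.
  by apply/eqP; rewrite subr_eq addrAC eq_sym subr_eq -!natrD E.
- move=> x; rewrite inE => /andP[/ffun_onP xA].
  rewrite sum_signed_dilate subr_eq0 => /eqP E.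
  apply: contra free => /injectiveP xinj.
  have wex i : exists y, (y \in A) && (x i == io y).
    by have /imsetP[y yA ->] := xA i; exists y; rewrite yA eqxx.
  pose w i := xchoose (wex i).
  have wA i : w i \in A by have := xchooseP (wex i) => /andP[].
  have wx i : x i = io (w i) by have := xchooseP (wex i) => /andP[_ /eqP].
  (* The group solution is lifted to integers, and [swap_sign] restores the signs of [a]. *)
  apply/existsP; exists [ffun i => w (swap_sign a i)]; apply/and3P; split.
  + apply/injectiveP => i j; rewrite !ffunE => wij.
    by apply: (inv_inj (swap_signK a)); apply: xinj; rewrite !wx wij.
  + by apply/forallP => i; rewrite ffunE.
  + have : (\sum_i w (lshift k i) * b i = \sum_i w (rshift k i) * b i)%N.
      have bd (v : 'I_k -> 'I_N.+1) : (\sum_i v i * b i < M)%N.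
        apply: (@leq_ltn_trans (h * N)); last by rewrite /M; nia.
        rewrite /h /l1norm big_distrl /=; apply: leq_sum => i _.
        by rewrite mulnC leq_mul2l lt_ord orbT.
      apply: (@Zp_nat_inj M); rewrite ?bd // !natr_sum.
      have Es (s : 'I_k -> 'I_(k + k)) :
          \sum_i x (s i) *+ b i = \sum_i (w (s i) * b i)%:R.
        by apply: eq_bigr => i _; rewrite wx -mulrnA.
      by rewrite -!Es.
    move/(@symmetric_solution_swap k a (fun i => w i : nat)).
    congr (is_true (symmetric_solution a _)).
    by apply/funext => i; rewrite ffunE.
- by rewrite card_ord.
Qed.

(** Separates the power of [K] from a constant depending only on [k] and [h]. *)
Lemma bound_monomial k h : exists c : nat, forall K : nat,
  (8 * K * ((k + k) ^ 2 * (2 ^ 14 * (2 * K) ^ 10) ^ h) =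
   c * K ^ (10 * h + 1))%N.
Proof.
exists (8 * ((k + k) ^ 2 * (2 ^ 14 * 2 ^ 10) ^ h))%N => K.
have -> : ((2 ^ 14 * (2 * K) ^ 10) ^ h =
    (2 ^ 14 * 2 ^ 10) ^ h * K ^ (10 * h))%N.
  by rewrite (expnMn 2 K) mulnA (expnMn (_ * _)) -(expnM K).
rewrite expnD expn1.
by move: ((2 ^ 14 * 2 ^ 10) ^ h)%N (K ^ (10 * h))%N => u v; ring.
Qed.

(** * Passage to real exponents *)

Section Asymptotics.
Variable R : realType.

Lemma free_set_powR_bound k h c n N :
  (0 < h)%N -> (0 < N)%N ->
  (forall K : nat, ((k + k) ^ 2 * (2 * h * N).+2 <= K * n ^ 2 ->
     n <= c * K ^ (10 * h + 1)))%N ->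
  n%:R <= (1 + c%:R * (4 * h * (k + k) ^ 2 + 1)%:R ^+ (10 * h + 1)) *
     N%:R `^ (1 / 2 - 1 / (100 * h%:R)) :> R.
Proof.
move=> h0 N0 Hn; set g : R := 1 / 2 - _; set D := (4 * h * (k + k) ^ 2 + 1)%N.
pose d : R := 1 / (100 * h%:R).
have hR : 1 <= h%:R :> R by rewrite ler1n.
have NR : 1 <= N%:R :> R by rewrite ler1n.
have d0 : 0 < d by rewrite divr_gt0 // mulr_gt0 //; lra.
have [le|lt] := leP (n%:R : R) (N%:R `^ g).
  by apply: le_trans le _; rewrite ler_peMl ?powR_ge0 // lerDl mulr_ge0.
have n0 : (0 < n)%N by rewrite -(ltr0n R) (le_lt_trans (powR_ge0 _ _) lt).
have n2 : (0 < n ^ 2)%N by rewrite expn_gt0 n0.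
(* A quotient rounded up, so that the hypothesis of [Hn] holds; it has order [N / n^2]. *)
pose K := (((k + k) ^ 2 * (2 * h * N).+2) %/ n ^ 2).+1.
have {Hn} Hn : (n <= c * K ^ (10 * h + 1))%N.
  by apply: Hn; rewrite ltnW // ltn_ceil.
have tw : N%:R `^ (1 - 2 * d) <= n%:R ^+ 2 :> R.
  have -> : 1 - 2 * d = g * 2%:R by rewrite /g -/d; lra.
  by rewrite powRrM powR_mulrn ?powR_ge0 // lerXn2r ?nnegrE ?powR_ge0 // ltW.
have N1 : N%:R = N%:R `^ (1 - 2 * d) * N%:R `^ (2 * d) :> R.
  by rewrite -powRD ?subrK ?powRr1 //; apply/implyP => _; lra.
have NK : 1 <= N%:R `^ (2 * d) :> R.
  by rewrite -[leLHS](powRr0 N%:R) ler_powR //; lra.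
(* The [+ 1] in [D] absorbs the rounding, as [N^(2d) >= 1]. *)
have KR : K%:R <= D%:R * N%:R `^ (2 * d) :> R.
  have h1 : ((K.-1) * n ^ 2 <= 4 * h * (k + k) ^ 2 * N)%N.
    apply: leq_trans (leq_trunc_div _ _) _.
    have M4 : ((2 * h * N).+2 <= 4 * h * N)%N by nia.
    by apply: leq_trans (leq_mul (leqnn _) M4) _; apply/eq_leq; ring.
  rewrite -[K]/(K.-1.+1) -natr1 /D natrD mulrDl mul1r lerD //.
  have n2R : 0 < n%:R ^+ 2 :> R by rewrite -natrX ltr0n.
  rewrite -(ler_pM2r n2R) -[in leLHS]natrX -natrM.
  apply: (@le_trans _ _ ((4 * h * (k + k) ^ 2 * N)%:R)).
    by rewrite ler_nat.
  rewrite natrM {1}N1 -mulrA ler_wpM2l // mulrC ler_wpM2l ?powR_ge0 //.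
apply: (@le_trans _ _ (c%:R * (D%:R ^+ (10 * h + 1) * N%:R `^ g))).
  apply: (@le_trans _ _ (c * K ^ (10 * h + 1))%:R); first by rewrite ler_nat.
  rewrite natrM ler_wpM2l // natrX.
  apply: (@le_trans _ _ ((D%:R * N%:R `^ (2 * d)) ^+ (10 * h + 1))).
    by rewrite lerXn2r ?nnegrE ?mulr_ge0 ?powR_ge0.
  rewrite exprMn ler_wpM2l ?exprn_ge0 // -powR_mulrn ?powR_ge0 // -powRrM.
  rewrite ler_powR // /g -/d natrD natrM.
  (* It remains to see that [2d (10h + 1) <= 1/2 - d], that is [(20h + 3) d <= 50 h d], which holds
     as [h >= 1]. *)
  have -> : 1 / 2 = 50 * (h%:R * d) by rewrite /d; field; lra.
  by have := d0; have := hR; nra.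
by rewrite mulrA ler_wpM2r ?powR_ge0 // lerDr.
Qed.

End Asymptotics.

Local Open Scope classical_set_scope.

Theorem theorem1 (R : realType) :
  exists c : nat -> R,
    (forall k : nat, 0 < c k) /\
    forall (k : nat) (a : 'I_k -> int),
      (3 <= k)%N -> (forall i : 'I_k, a i <> 0) ->
      (fun N : nat => (max_free a N)%:R : R^o) =O_\oo
        (fun N : nat => N%:R `^ (1 / 2 - 1 / (c k * (l1norm a)%:R)) : R^o).
Proof.
(* An absolute constant serves for every [k]; the dependence on [k] enters only the implied
   constant. *)
exists (fun=> 100); split=> // k a k3 a0.
have h0 : (0 < l1norm a)%N.
  apply: leq_trans (abs_le_l1norm a (Ordinal (ltnW (ltnW k3)))).
  by rewrite absz_gt0; apply/eqP.
have [c Hc] := bound_monomial k (l1norm a).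
pose C : R :=
  1 + c%:R * (4 * l1norm a * (k + k) ^ 2 + 1)%:R ^+ (10 * l1norm a + 1).
have C0 : 0 < C by rewrite ltr_wpDr // mulr_ge0 // exprn_ge0.
apply/eqO_exP; exists C => //.
near=> N.
have N0 : (0 < N)%N by near: N; exists 1%N.
rewrite !ger0_norm ?powR_ge0 //.
rewrite /max_free; elim/big_ind: _ => [|m n|A /andP[_ free]].
- by rewrite mulr_ge0 ?powR_ge0 // ltW.
- by rewrite /maxn; case: ifP.
- apply: free_set_powR_bound => // K HK.
  have [->|A0] := posnP #|A|; first by [].
  by rewrite -Hc; apply: free_set_bound k3 a0 A0 free HK.
Unshelve. all: by end_near.
Qed.
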